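(* Let $C=(C_\bullet,d,t)$ be a quasi-precyclic $k$-module. (1) $\widetilde{CC}:=(CC_{\bullet,\bullet},\tilde\partial,\hat\delta)$ is a chain bicomplex and $\widetilde C^{\natural\natural}:=(C^{\natural\natural}_\bullet,\tilde\partial+\delta,u^{-2})$ is an $S$-module. (2) The projection $\pi^T:C_\bullet\to C_\bullet$ (acting on coefficients, $xu^p\mapsto\pi^T(x)u^p$) yields an $S$-homotopy equivalence between $C^{\natural\natural}$ and $\widetilde C^{\natural\natural}$.
   Context: $k$ is a unital ring, not assumed commutative; $k$-modules are left modules. A para-$S$-module $(C_\bullet,d,S,T)$ consists of $k$-modules $C_m$ ($m\ge 0$), $k$-linear maps $d:C_\bullet\to C_{\bullet-1}$, $S:C_\bullet\to C_{\bullet-2}$ and a $k$-linear isomorphism $T:C_\bullet\to C_\bullet$ such that $d^2=S(1-T)$ and $d,S,T$ commute pairwise. When $T=1$ it is called an $S$-module (so $(C_\bullet,d)$ is a chain complex and $S$ a chain map). An $S$-map is a degree $0$ $k$-linear map commuting with $d,S,T$. An $S$-homotopy equivalence between para-$S$-modules $C,\bar C$ is given by $S$-maps $f:C_\bullet\to\bar C_\bullet$, $g:\bar C_\bullet\to C_\bullet$ such that $gf-1=d\varphi+\varphi d$ and $fg-1=d\psi+\psi d$ for $k$-linear maps $\varphi,\psi$ of degree $+1$ commuting with $S$ and $T$. A para-precyclic $k$-module consists of $k$-modules $C_m$, $m\ge0$, face maps $d_j:C_m\to C_{m-1}$ ($0\le j\le m$) with $d_id_j=d_{j-1}d_i$ for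 $i<j$, and an invertible $k$-linear map $t:C_\bullet\to C_\bullet$ of degree $0$ with $td_i=d_{i+1}t$ for $0\le i\le m-1$ and $d_m=d_0t$ on $C_m$. The notation $(C_\bullet,d,t)$ uses $d=d_m$ on $C_m$. Put $T=t^{m+1}$ on $C_m$; it commutes with $d$ and $t$. It is quasi-precyclic if $C_\bullet=\ker(1-T)\oplus\operatorname{ran}(1-T)$; then $\pi^T:C_\bullet\to C_\bullet$ denotes the projection onto $\ker(1-T)$ along $\operatorname{ran}(1-T)$. Let $b=\sum_{j=0}^m(-1)^jd_j$, $b'=\sum_{j=0}^{m-1}(-1)^jd_j$, $\tau=(-1)^mt$, $N=1+\tau+\cdots+\tau^m$ on $C_m$, and $\tilde N=N\pi^T=\pi^TN$. Let $C^{\natural\natural}_m=\bigoplus_{p+q=m}C_qu^p$ ($p,q\ge0$), with $u$ a formal variable, $u^{-1}(xu^p)=xu^{p-1}$ for $p\ge1$, $u^{-1}(xu^0)=0$, and $T$ acting on coefficients. Let $\partial(xu^{2p+1})=(1-\tau)xu^{2p}$, $\partial(xu^{2p})=Nxu^{2p-1}$ for $p\ge1$, $\partial(xu^0)=0$; $\delta(xu^{2p})=bxu^{2p}$, $\delta(xu^{2p+1})=-b'xu^{2p+1}$. $C^{\natural\natural}=(C^{\natural\natural}_\bullet,\partial+\delta,u^{-2},T)$ is a para-$S$-module. The map $\tilde\partial$ is defined like $\partial$ with $\tilde N$ in place of $N$. Further $CC_{p,q}=C_qu^p$ and $\hat\delta(xu^{2p})=bxu^{2p}$, $\hat\delta(xu^{2p+1})=b'xu^{2p+1}$.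 A chain bicomplex here means a bigraded module with two square-zero differentials lowering $p$, respectively $q$, by one and commuting with each other. *)

(* Defs.v *)
From HB Require Import structures.
From mathcomp Require Import all_boot all_order all_algebra.
From mathcomp Require Import boolp classical_sets.

Set Implicit Arguments.
Unset Strict Implicit.
Unset Printing Implicit Defensive.

Import GRing.Theory.

Local Open Scope ring_scope.

(** ** Finite direct sums of a dependent family of modules *)

Section DirectSum.
Variables (k : pzRingType) (I : finType) (V : I -> lmodType k).

Definition dirsum : Type := {dffun forall i : I, V i}.

Definition dirsum_mk (f : forall i, V i) : dirsum := finfun f.
Definition dirsum_coef (x : dirsum) (i : I) : V i := (x : {dffun _}) i.

Lemma dirsum_mkE f i : dirsum_coef (dirsum_mk f) i = f i.
Proof. exact: ffunE. Qed.

Lemma dirsumP (x y : dirsum) :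
  (forall i, dirsum_coef x i = dirsum_coef y i) <-> x = y.
Proof. by split=> [e|-> //]; apply/ffunP=> i; apply: e. Qed.

HB.instance Definition _ := Choice.copy dirsum {dffun forall i : I, V i}.

Definition dirsum_zero : dirsum := dirsum_mk (fun=> 0).
Definition dirsum_opp (x : dirsum) : dirsum :=
  dirsum_mk (fun i => - dirsum_coef x i).
Definition dirsum_add (x y : dirsum) : dirsum :=
  dirsum_mk (fun i => dirsum_coef x i + dirsum_coef y i).
Definition dirsum_scale (a : k) (x : dirsum) : dirsum :=
  dirsum_mk (fun i => a *: dirsum_coef x i).

Fact dirsum_addA : associative dirsum_add.
Proof. by move=> x y z; apply/dirsumP=> i; rewrite !dirsum_mkE addrA. Qed.
Fact dirsum_addC : commutative dirsum_add.
Proof. by move=> x y; apply/dirsumP=> i; rewrite !dirsum_mkE addrC. Qed.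
Fact dirsum_add0 : left_id dirsum_zero dirsum_add.
Proof. by move=> x; apply/dirsumP=> i; rewrite !dirsum_mkE add0r. Qed.
Fact dirsum_addN : left_inverse dirsum_zero dirsum_opp dirsum_add.
Proof. by move=> x; apply/dirsumP=> i; rewrite !dirsum_mkE addNr. Qed.

HB.instance Definition _ := GRing.isZmodule.Build dirsum
  dirsum_addA dirsum_addC dirsum_add0 dirsum_addN.

Fact dirsum_scaleA a b x :
  dirsum_scale a (dirsum_scale b x) = dirsum_scale (a * b) x.
Proof. by apply/dirsumP=> i; rewrite !dirsum_mkE scalerA. Qed.
Fact dirsum_scale1 : left_id 1 dirsum_scale.
Proof. by move=> x; apply/dirsumP=> i; rewrite !dirsum_mkE scale1r. Qed.
Fact dirsum_scaleDr : right_distributive dirsum_scale +%R.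
Proof. by move=> a x y; apply/dirsumP=> i; rewrite !dirsum_mkE scalerDr. Qed.
Fact dirsum_scaleDl x : {morph dirsum_scale^~ x : a b / a + b}.
Proof. by move=> a b; apply/dirsumP=> i; rewrite !dirsum_mkE scalerDl. Qed.

HB.instance Definition _ := GRing.Zmodule_isLmodule.Build k dirsum
  dirsum_scaleA dirsum_scale1 dirsum_scaleDr dirsum_scaleDl.

Lemma dirsum_coef_is_linear i : linear (dirsum_coef^~ i).
Proof. by move=> a x y; rewrite !dirsum_mkE. Qed.

End DirectSum.

(** ** Para-S-modules

Chains live in degrees [m >= 0] and every module of negative degree is 0; an
identity with values in a negative degree is void and is not written. *)

Record paraSData (k : pzRingType) := ParaSData {
  psC :> nat -> lmodType k;
  psd : forall m, psC m.+1 -> psC m;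
  psS : forall m, psC m.+2 -> psC m;
  psT : forall m, psC m -> psC m
}.

Arguments psd {k X m} : rename.
Arguments psS {k X m} : rename.
Arguments psT {k X m} : rename.

Definition is_paraS (k : pzRingType) (X : paraSData k) : Prop :=
  [/\ [/\ forall m, linear (@psd k X m),
          forall m, linear (@psS k X m),
          forall m, linear (@psT k X m)
        & forall m, bijective (@psT k X m)],
      forall m (x : X m.+2), psd (psd x) = psS (x - psT x)
    & [/\ forall m (x : X m.+3), psd (psS x) = psS (psd x),
          forall m (x : X m.+1), psd (psT x) = psT (psd x)
        & forall m (x : X m.+2), psS (psT x) = psT (psS x)]].

Definition is_S_module (k : pzRingType) (X : paraSData k) : Prop :=
  is_paraS X /\ forall m (x : X m), psT x = x.

Definition is_S_map (k : pzRingType) (X Y : paraSData k)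
    (f : forall m, X m -> Y m) : Prop :=
  [/\ forall m, linear (f m),
      forall m (x : X m.+1), f m (psd x) = psd (f m.+1 x),
      forall m (x : X m.+2), f m (psS x) = psS (f m.+2 x)
    & forall m (x : X m), f m (psT x) = psT (f m x)].

(* [h - 1 = d phi + phi d] with [phi] of degree +1 commuting with [S], [T].
   Since [S] vanishes on degree 1 but [phi] maps degree 1 to degree 2,
   [S phi = phi S] reads [S phi = 0] on degree 1. *)
Definition S_homotopic_to_id (k : pzRingType) (X : paraSData k)
    (h : forall m, X m -> X m) : Prop :=
  exists phi : forall m, X m -> X m.+1,
    [/\ forall m, linear (phi m),
        (forall m (x : X m.+2), psS (phi m.+2 x) = phi m (psS x)) /\
        (forall x : X 1%N, psS (phi 1%N x) = 0),
        forall m (x : X m), psT (phi m x) = phi m (psT x)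
      & (forall x : X 0%N, h 0%N x - x = psd (phi 0%N x)) /\
        (forall m (x : X m.+1),
           h m.+1 x - x = psd (phi m.+1 x) + phi m (psd x))].

Definition S_homotopy_equivalence (k : pzRingType) (X Y : paraSData k)
    (f : forall m, X m -> Y m) (g : forall m, Y m -> X m) : Prop :=
  [/\ is_paraS X /\ is_paraS Y, is_S_map f, is_S_map g,
      S_homotopic_to_id (fun m x => g m (f m x))
    & S_homotopic_to_id (fun m y => f m (g m y))].

(** ** Chain bicomplexes, with commuting differentials *)

Definition is_chain_bicomplex (k : pzRingType) (B : nat -> nat -> lmodType k)
    (dh : forall p q, B p.+1 q -> B p q)
    (dv : forall p q, B p q.+1 -> B p q) : Prop :=
  [/\ (forall p q, linear (dh p q)) /\ (forall p q, linear (dv p q)),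
      forall p q (x : B p.+2 q), dh p q (dh p.+1 q x) = 0,
      forall p q (x : B p q.+2), dv p q (dv p q.+1 x) = 0
    & forall p q (x : B p.+1 q.+1), dh p q (dv p.+1 q x) = dv p q (dh p q.+1 x)].

(** ** Para-precyclic modules *)

(* [pcface m j] is the face [d_j] on [C_{m+1}], for [0 <= j <= m + 1]; the
   ordinals [inord _] below are always within bounds. *)
Record paraPrecyclic (k : pzRingType) := ParaPrecyclic {
  pcC :> nat -> lmodType k;
  pcface : forall m, 'I_m.+2 -> {linear pcC m.+1 -> pcC m};
  pct : forall m, {linear pcC m -> pcC m};
  pcface_face : forall m (i j : nat) (x : pcC m.+2), (i < j <= m.+2)%N ->
    @pcface m (inord i) (@pcface m.+1 (inord j) x) =
    @pcface m (inord j.-1) (@pcface m.+1 (inord i) x);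
  pct_bij : forall m, bijective (pct m);
  pct_face : forall m (i : nat) (x : pcC m.+1), (i <= m)%N ->
    pct m (@pcface m (inord i) x) = @pcface m (inord i.+1) (pct m.+1 x);
  pcface_max : forall m (x : pcC m.+1),
    @pcface m ord_max x = @pcface m ord0 (pct m.+1 x)
}.

Arguments pcface {k} C {m} : rename.
Arguments pct {k} C {m} : rename.

Definition direct_sum_decomposition (k : pzRingType) (V : lmodType k)
    (A B : set V) : Prop :=
  (forall x, exists y z, [/\ A y, B z & x = y + z]) /\
  (forall x, A x -> B x -> x = 0).

Section Operators.
Variables (k : pzRingType) (C : paraPrecyclic k).

Definition pcT m (x : C m) : C m := iter m.+1 (pct C) x.

Definition ker1T m : set (C m) := fun x => x - pcT x = 0.
Definition ran1T m : set (C m) := fun x => exists y, x = y - pcT y.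

Definition quasi_precyclic : Prop :=
  forall m, direct_sum_decomposition (@ker1T m) (@ran1T m).

(* The projection onto [ker (1 - T)] along [ran (1 - T)]; in the
   quasi-precyclic case exactly one [y] qualifies and the default 0 is unused. *)
Definition piT m (x : C m) : C m :=
  xget 0 (fun y => ker1T y /\ ran1T (x - y)).

Definition pcb m (x : C m.+1) : C m :=
  \sum_(j < m.+2) (-1) ^+ j *: pcface C j x.

Definition pcb' m (x : C m.+1) : C m :=
  \sum_(j < m.+1) (-1) ^+ j *: pcface C (widen_ord (leqnSn m.+1) j) x.

Definition pctau m (x : C m) : C m := (-1) ^+ m *: pct C x.

Definition pcN m (x : C m) : C m := \sum_(i < m.+1) iter i (@pctau m) x.

Definition pcNtilde m (x : C m) : C m := pcN (piT x).

(** *** The bicomplex with [CC_{p,q} = C_q u^p] *)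

Definition CC (p q : nat) : lmodType k := C q.

(* The horizontal map from [C_q u^(p+1)] to [C_q u^p], where [M] stands for
   [N] or its modification [Ñ]. *)
Definition partialop (M : forall q, C q -> C q) p q (x : CC p.+1 q) : CC p q :=
  if odd p.+1 then (x : C q) - pctau x else M q x.

Definition delta p q (x : CC p q.+1) : CC p q :=
  if odd p then - pcb' x else pcb x.

Definition deltahat p q (x : CC p q.+1) : CC p q :=
  if odd p then pcb' x else pcb x.

(** *** The total module *)

(* Degree [m] is the direct sum of the [C_q u^(m - q)] for [q <= m]: an element
   is the family, indexed by [q], of its coefficients in [C_q]. *)
Definition natC (m : nat) : lmodType k :=
  dirsum (fun q : 'I_m.+1 => CC (m - q) q).

(* The coefficient in [C_q] of [u^(m - q)]. *)
Definition natcoef m (y : natC m) q (le_qm : (q <= m)%N) : C q :=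
  dirsum_coef y (Ordinal (le_qm : (q < m.+1)%N)).

Definition natd (M : forall q, C q -> C q) m (y : natC m.+1) : natC m :=
  dirsum_mk (fun q : 'I_m.+1 =>
    partialop M (p := m - q) (natcoef y (leqW (leq_ord q)))
    + delta (p := m - q) (natcoef y (ltn_ord q))).

Definition natuinv m (y : natC m.+1) : natC m :=
  dirsum_mk (fun q : 'I_m.+1 => natcoef y (leqW (leq_ord q))).

Definition natS m (y : natC m.+2) : natC m := natuinv (natuinv y).

Definition natmap (f : forall q, C q -> C q) m (y : natC m) : natC m :=
  dirsum_mk (fun q : 'I_m.+1 => f q (natcoef y (leq_ord q))).

Definition natnat : paraSData k :=
  ParaSData (@natd pcN) natS (@natmap pcT).

Definition natnat_tilde : paraSData k :=
  ParaSData (@natd pcNtilde) natS (fun m y => y).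

Definition natpi : forall m, natC m -> natC m := natmap piT.

End Operators.

(* Main.v *)
Require Import Defs.
From mathcomp Require Import all_boot all_order all_algebra.
From HB Require Import structures.
From mathcomp Require Import boolp classical_sets.

Set Implicit Arguments.
Unset Strict Implicit.
Unset Printing Implicit Defensive.

Import GRing.Theory.

Local Open Scope ring_scope.

(** Everything rests on four identities that hold in every para-precyclic
    module: [b^2 = b'^2 = 0], [b (1 - tau) = (1 - tau) b'], [b' N = N b] and
    [(1 - tau) N = N (1 - tau) = 1 - T].  The last three show that [b] and
    [b'] commute with [T]: for instance
    [b (1 - T) = b (1 - tau) N = (1 - tau) b' N = (1 - tau) N b = (1 - T) b].

    In the quasi-precyclic case [1 - T] is bijective on [ran (1 - T)].  Let [R]
    be its inverse there, extended by 0 on [ker (1 - T)], so that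
    [(1 - T) R = R (1 - T) = 1 - pi].  A linear map that commutes with [T]
    preserves the decomposition, hence commutes with [pi] and with [R]
    ([piT_map], [inv1T_map]).  Replacing [N] by [N pi] therefore keeps
    [b' N = N b] and turns [1 - T] into [(1 - T) pi = 0]; this gives the
    bicomplex and the S-module.

    For the equivalence, [pi] intertwines the two differentials, and [pi] is
    idempotent, so both composites are [pi] and one has to contract the part
    of the total module where [1 - T] is invertible.  A homotopy is
    [phi (x u^(2p)) = - N R x u^(2p+1)], [phi (x u^(2p+1)) = 0].  Indeed, on
    [x u^(2p)] the part [phi d + d phi] coming from the horizontal map is
    [- (1 - tau) N R x = - (1 - pi) x], on [x u^(2p+1)] it is
    [- N R (1 - tau) x = - (1 - pi) x], and the vertical contributions cancel
    by [b' N R = N R b].  The map [phi] is only ever combined with [1 - tau]: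
    the horizontal map out of an even column lands in an odd one, where [phi]
    vanishes.  So the same [phi] serves for both total modules, whichever of
    [N] and [N pi] stands in the differential ([natpi_homotopy]). *)

(** * Linearity of iterates, signed maps and sums *)

Lemma iter_is_linear (k : pzRingType) (V : lmodType k) (f : {linear V -> V}) n :
  linear (iter n f).
Proof. by elim: n => [//|n IH] a x y; rewrite !iterS IH linearP. Qed.

HB.instance Definition _ k (V : lmodType k) (f : {linear V -> V}) n :=
  GRing.isLinear.Build k V V *:%R (iter n f) (iter_is_linear f n).

(** A scalar of a noncommutative ring does not act linearly in general; a sign
    does, being central. *)
Lemma sign_scale_is_linear (k : pzRingType) (V W : lmodType k) n
    (f : {linear V -> W}) :
  linear (fun x => (-1) ^+ n *: f x).
Proof.
by move=> a x y; rewrite linearP scalerDr !scalerA commr_sign.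
Qed.

Lemma linear_sign (k : pzRingType) (V W : lmodType k) n
    (f : {linear V -> W}) x :
  f ((-1) ^+ n *: x) = (-1) ^+ n *: f x.
Proof. exact: linearZ. Qed.

Lemma sum_is_linear (k : pzRingType) (V W : lmodType k) n
    (f : 'I_n -> {linear V -> W}) :
  linear (fun x => \sum_(i < n) f i x).
Proof.
move=> a x y; rewrite scaler_sumr -big_split /=.
by apply: eq_bigr => i _; rewrite linearP.
Qed.

(** * Faces with signs *)

Section QuasiPrecyclic.
Variables (k : pzRingType) (C : paraPrecyclic k).

HB.instance Definition _ m := GRing.isLinear.Build k (C m) (C m) *:%R
  (@pctau k C m) (sign_scale_is_linear m (pct C)).

HB.instance Definition _ m := GRing.isLinear.Build k (C m) (C m) *:%R
  (@pcT k C m) (iter_is_linear (pct C) m.+1).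

HB.instance Definition _ m := GRing.isLinear.Build k (C m) (C m) *:%R
  (@pcN k C m) (sum_is_linear (fun i : 'I_m.+1 => iter i (@pctau k C m))).

(** With the signs absorbed into [sface j], the face relations and the relations
    between faces and [tau] carry no signs depending on the degree. *)
Definition sface m j (x : C m.+1) : C m := (-1) ^+ j *: pcface C (inord j) x.

HB.instance Definition _ m j := GRing.isLinear.Build k (C m.+1) (C m) *:%R
  (@sface m j) (sign_scale_is_linear j (pcface C (inord j))).

(** [altface n] is [b'] or [b] on [C_(m+1)] for [n = m + 1] or [n = m + 2]; the
    truncations in between are what the induction for [b^2 = 0] runs over. *)
Definition altface n m (x : C m.+1) : C m := \sum_(j < n) sface j x.

HB.instance Definition _ n m := GRing.isLinear.Build k (C m.+1) (C m) *:%R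
  (@altface n m) (sum_is_linear (fun j : 'I_n => @sface m j)).

Lemma pcbE m (x : C m.+1) : pcb x = altface m.+2 x.
Proof. by apply: eq_bigr => j _; rewrite /sface inord_val. Qed.

Lemma pcb'E m (x : C m.+1) : pcb' x = altface m.+1 x.
Proof.
apply: eq_bigr => j _; rewrite /sface; congr (_ *: pcface C _ x).
by apply: val_inj; rewrite /= inordK // (leqW (ltn_ord j)).
Qed.

Fact pcb_is_linear m : linear (@pcb k C m).
Proof. by move=> a x y; rewrite !pcbE linearP. Qed.

HB.instance Definition _ m := GRing.isLinear.Build k (C m.+1) (C m) *:%R
  (@pcb k C m) (@pcb_is_linear m).

Fact pcb'_is_linear m : linear (@pcb' k C m).
Proof. by move=> a x y; rewrite !pcb'E linearP. Qed.

HB.instance Definition _ m := GRing.isLinear.Build k (C m.+1) (C m) *:%R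
  (@pcb' k C m) (@pcb'_is_linear m).

Lemma sface_sface m i j (x : C m.+2) : (i <= j < m.+2)%N ->
  sface i (sface j.+1 x) = - sface j (sface i x).
Proof.
move=> /andP[le_ij lt_jm]; rewrite /sface !linear_sign.
rewrite pcface_face ?ltnS ?le_ij //= !scalerA -!exprD addnS exprS mulN1r.
by rewrite scaleNr scalerN addnC.
Qed.

(** Passing from [n] to [n + 1] adds the terms [d_i d_(n+1)] for [i <= n], which
    equal [- d_n d_i] and so cancel against the terms [d_n d_i] added on the
    other side.  It covers [b^2 = 0] and [b'^2 = 0] at once. *)
Lemma altface_altface n m (x : C m.+2) : (n <= m.+2)%N ->
  altface n (altface n.+1 x) = 0.
Proof.
elim: n => [|n IH] lt_nm; first by rewrite /altface big_ord0.
have altfaceS l q (y : C q.+1) : altface l.+1 y = altface l y + sface l y.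
  by rewrite /altface big_ord_recr.
rewrite [altface n.+2 x]altfaceS linearD /= altfaceS (IH (ltnW lt_nm)) add0r.
rewrite [altface n.+1 (sface _ _)]/altface [altface n.+1 x]/altface.
rewrite linear_sum -big_split big1 //= => i _.
by rewrite sface_sface ?subrr // lt_nm andbT -ltnS.
Qed.

Lemma pcb_pcb m (x : C m.+2) : pcb (pcb x) = 0.
Proof. by rewrite !pcbE altface_altface. Qed.

Lemma pcb'_pcb' m (x : C m.+2) : pcb' (pcb' x) = 0.
Proof. by rewrite !pcb'E altface_altface. Qed.

(** * Relations between b, b', tau, N and T *)

Lemma pctau_sface m j (x : C m.+1) : (j <= m)%N ->
  pctau (sface j x) = sface j.+1 (pctau x).
Proof.
move=> le_jm; rewrite /pctau /sface !linear_sign pct_face // !scalerA -!exprD.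
by rewrite addnS addSn !exprS !mulN1r opprK addnC.
Qed.

Lemma iter_pctau_sface m j s (x : C m.+1) : (j + s <= m.+1)%N ->
  iter s (@pctau k C m) (sface j x) =
  sface (j + s) (iter s (@pctau k C m.+1) x).
Proof.
elim: s => [|s IH] le_js; first by rewrite addn0.
by rewrite addnS in le_js *; rewrite !iterS IH ?pctau_sface // ltnW.
Qed.

Lemma sface0_pctau m (x : C m.+1) : sface 0 (pctau x) = sface m.+1 x.
Proof.
rewrite /sface /pctau linear_sign expr0 scale1r.
have -> : inord m.+1 = ord_max :> 'I_m.+2 by apply: val_inj; rewrite /= inordK.
have -> : inord 0 = ord0 :> 'I_m.+2 by apply: val_inj; rewrite /= inordK.
by rewrite pcface_max.
Qed.

Lemma pcb_recr m (x : C m.+1) : pcb x = pcb' x + sface m.+1 x.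
Proof. by rewrite pcbE pcb'E /altface big_ord_recr. Qed.

(** The rule [tau d_j = d_(j+1) tau] shifts the faces by one; the missing
    [d_0 tau] is the signed last face [D = sface m.+1].  With [b = b' + D] this
    also gives [b' tau = tau b' + D - D tau]. *)
Lemma pcb_pctau m (x : C m.+1) : pcb (pctau x) = sface m.+1 x + pctau (pcb' x).
Proof.
rewrite pcbE pcb'E /altface big_ord_recl sface0_pctau linear_sum /=.
by congr (_ + _); apply: eq_bigr => i _; rewrite pctau_sface // -ltnS.
Qed.

Lemma pcb_1Btau m (x : C m.+1) : pcb (x - pctau x) = pcb' x - pctau (pcb' x).
Proof. by rewrite linearB /= pcb_pctau pcb_recr addrKA. Qed.

Lemma pcb'_pctau m (x : C m.+1) :
  pcb' (pctau x) = sface m.+1 x + pctau (pcb' x) - sface m.+1 (pctau x).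
Proof. by rewrite -pcb_pctau pcb_recr addrK. Qed.

(** The truncations of [N], over which the induction for [b' N = N b] runs. *)
Definition tausum n m (x : C m) : C m := \sum_(l < n) iter l (@pctau k C m) x.

HB.instance Definition _ n m := GRing.isLinear.Build k (C m) (C m) *:%R
  (@tausum n m) (sum_is_linear (fun i : 'I_n => iter i (@pctau k C m))).

Lemma tausumS n m (x : C m) :
  tausum n.+1 x = tausum n x + iter n (@pctau k C m) x.
Proof. exact: big_ord_recr. Qed.

Lemma tausumSr n m (x : C m) : tausum n.+1 x = x + tausum n (pctau x).
Proof.
rewrite /tausum big_ord_recl; congr (_ + _).
by apply: eq_bigr => i _; rewrite -iterSr.
Qed.

Lemma tausum_pctau n m (x : C m) : tausum n (pctau x) = pctau (tausum n x).
Proof.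
by rewrite /tausum linear_sum; apply: eq_bigr => i _; rewrite -iterSr.
Qed.

(** Moving [b'] past the powers of [tau] one at a time by
    [b' tau = tau b' + D - D tau]: the terms [D] complete [b'] to [b], and the
    terms [D tau] stay behind.  At [n = m + 1] the last two terms cancel, which
    gives [b' N = N b]. *)
Lemma pcb'_tausum m n (x : C m.+1) :
  pcb' (tausum n.+1 x) = tausum n (pcb x) + iter n (@pctau k C m) (pcb' x) -
  \sum_(a < n) iter a (@pctau k C m)
                 (sface m.+1 (iter (n - a) (@pctau k C m.+1) x)).
Proof.
elim: n x => [|n IH] x; first by rewrite /tausum big_ord1 !big_ord0 add0r subr0.
rewrite tausumSr linearD /= IH pcb_pctau pcb'_pctau [in RHS]big_ord_recr /=.
rewrite subSnn /= pcb_recr.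
have -> : \sum_(a < n) iter a (@pctau k C m)
    (sface m.+1 (iter (n.+1 - a) (@pctau k C m.+1) x)) =
  \sum_(a < n) iter a (@pctau k C m)
    (sface m.+1 (iter (n - a) (@pctau k C m.+1) (pctau x))).
  by apply: eq_bigr => a _; rewrite -iterSr subSn // ltnW.
have -> : tausum n.+1 (pcb' x + sface m.+1 x) =
    pcb' x + tausum n (sface m.+1 x + pctau (pcb' x))
    + iter n (@pctau k C m) (sface m.+1 x).
  by rewrite !linearD /= tausumSr tausumS addrACA !addrA.
by rewrite !linearD linearN /= -iterSr !addrA [LHS]addrAC.
Qed.

(** The remainder of [pcb'_tausum] cancels because [D tau^(m+1-a)] is
    [tau^(m+1-a) d_a] up to sign, so that its sum over [a] is [tau^(m+1) b']. *)
Lemma pcb'_pcN m (x : C m.+1) : pcb' (pcN x) = pcN (pcb x).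
Proof.
rewrite -[pcN x]/(tausum m.+2 x) pcb'_tausum.
suff -> : \sum_(a < m.+1) iter a (@pctau k C m)
    (sface m.+1 (iter (m.+1 - a) (@pctau k C m.+1) x)) =
  iter m.+1 (@pctau k C m) (pcb' x) by rewrite addrK.
rewrite pcb'E linear_sum; apply: eq_bigr => a _.
have le_am : (a <= m.+1)%N := ltnW (ltn_ord a).
have -> : sface m.+1 (iter (m.+1 - a) (@pctau k C m.+1) x) =
    iter (m.+1 - a) (@pctau k C m) (sface a x).
  by rewrite iter_pctau_sface subnKC.
by rewrite -iterD subnKC.
Qed.

Lemma iter_pctau n m (x : C m) :
  iter n (@pctau k C m) x = (-1) ^+ (m * n) *: iter n (pct C) x.
Proof.
elim: n => [|n IH]; first by rewrite muln0 scale1r.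
by rewrite !iterS IH /pctau linear_sign scalerA -exprD mulnS.
Qed.

(** The sign of [tau^(m+1)] is that of [m (m + 1)], an even number. *)
Lemma iter_pctau_pcT m (x : C m) : iter m.+1 (@pctau k C m) x = pcT x.
Proof.
by rewrite iter_pctau -signr_odd oddM oddS andbN scale1r.
Qed.

Lemma pctau_pcN m (x : C m) : pctau (pcN x) = pcN (pctau x).
Proof. by rewrite -[pcN (pctau x)]/(tausum m.+1 _) tausum_pctau. Qed.

Lemma pcN_1Btau m (x : C m) : pcN (x - pctau x) = x - pcT x.
Proof.
rewrite linearB /= -iter_pctau_pcT.
rewrite -[pcN x]/(tausum m.+1 x) -[pcN (pctau x)]/(tausum m.+1 (pctau x)).
rewrite [tausum m.+1 x]tausumSr.
by rewrite [tausum m.+1 (pctau x)]tausumS -iterSr opprD addrA addrK.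
Qed.

Lemma pcN_sub_pctau m (x : C m) : pcN x - pctau (pcN x) = x - pcT x.
Proof. by rewrite pctau_pcN -linearB /= pcN_1Btau. Qed.

Lemma pctau_pcT m (x : C m) : pctau (pcT x) = pcT (pctau x).
Proof. by rewrite -!iter_pctau_pcT -iterSr. Qed.

Lemma pcN_pcT m (x : C m) : pcN (pcT x) = pcT (pcN x).
Proof.
rewrite [RHS]linear_sum; apply: eq_bigr => i _ /=.
by rewrite -!iter_pctau_pcT -!iterD addnC.
Qed.

(** [T] commutes with [b] and [b'] because [1 - T] factors both as
    [(1 - tau) N] and as [N (1 - tau)]. *)
Lemma pcb_pcT m (x : C m.+1) : pcb (pcT x) = pcT (pcb x).
Proof.
suff: pcb (x - pcT x) = pcb x - pcT (pcb x).
  by rewrite linearB => /addrI/oppr_inj.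
by rewrite -pcN_sub_pctau pcb_1Btau pcb'_pcN pcN_sub_pctau.
Qed.

Lemma pcb'_pcT m (x : C m.+1) : pcb' (pcT x) = pcT (pcb' x).
Proof.
suff: pcb' (x - pcT x) = pcb' x - pcT (pcb' x).
  by rewrite linearB => /addrI/oppr_inj.
by rewrite -pcN_1Btau pcb'_pcN pcb_1Btau pcN_1Btau.
Qed.

Lemma pcT_bij m : bijective (@pcT k C m).
Proof.
rewrite /pcT; elim: m.+1 => [|n IH]; first by exists id.
exact: bij_comp (pct_bij C m) IH.
Qed.

(** * The total module in coordinates *)

(** Extending the coefficient function by 0 outside the range [q <= m] frees
    the computations from proofs of bounds: the coefficient in [C_(q+1)] of an
    element that has none is 0. *)
Definition coef m (y : natC C m) (q : nat) : C q :=
  if decP (@idP (q <= m)%N) is left h then natcoef y h else 0.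

Lemma natcoefE m (y : natC C m) q (h : (q <= m)%N) : natcoef y h = coef y q.
Proof.
by rewrite /coef; case: decP => // h'; rewrite (bool_irrelevance h h').
Qed.

Lemma coef_gt m (y : natC C m) q : (m < q)%N -> coef y q = 0.
Proof. by rewrite /coef ltnNge => /negP h; case: decP => // /h. Qed.

Lemma coef_mk m (F : forall q, C q) q : (q <= m)%N ->
  coef (dirsum_mk (fun i : 'I_m.+1 => F i) : natC C m) q = F q.
Proof. by move=> h; rewrite -(natcoefE _ h) /natcoef dirsum_mkE. Qed.

Lemma coefP m (x y : natC C m) :
  (forall q, (q <= m)%N -> coef x q = coef y q) -> x = y.
Proof.
move=> e; apply/dirsumP => -[q h].
by have := e q h; rewrite -!(natcoefE _ (h : q <= m)%N).
Qed.

Fact coef_is_linear m q : linear (fun y : natC C m => coef y q).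
Proof.
move=> a x y; case: (leqP q m) => h; last by rewrite !coef_gt // scaler0 addr0.
rewrite -!(natcoefE _ h).
exact: (dirsum_coef_is_linear (Ordinal (h : q < m.+1)%N) a x y).
Qed.

Lemma coefD m (x y : natC C m) q : coef (x + y) q = coef x q + coef y q.
Proof. by rewrite -[x]scale1r coef_is_linear !scale1r. Qed.

Lemma coefB m (x y : natC C m) q : coef (x - y) q = coef x q - coef y q.
Proof. by rewrite -scaleN1r addrC coef_is_linear scaleN1r addrC. Qed.

Lemma coef_natuinv m (y : natC C m.+1) q : (q <= m)%N ->
  coef (natuinv y) q = coef y q.
Proof.
move=> h; rewrite -(natcoefE _ h) /natcoef dirsum_mkE /=.
exact: natcoefE.
Qed.

Lemma coef_natS m (y : natC C m.+2) q : (q <= m)%N ->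
  coef (natS y) q = coef y q.
Proof. by move=> h; rewrite !coef_natuinv // ltnW. Qed.

Lemma coef_natmap (f : forall q, C q -> C q) m (y : natC C m) q : (q <= m)%N ->
  coef (natmap f y) q = f q (coef y q).
Proof.
by move=> h; rewrite -(natcoefE _ h) /natcoef dirsum_mkE /= natcoefE.
Qed.

Lemma coef_natd M m (y : natC C m.+1) q : (q <= m)%N ->
  coef (natd M y) q =
  if odd (m - q) then M q (coef y q) - pcb' (coef y q.+1)
  else (coef y q - pctau (coef y q)) + pcb (coef y q.+1).
Proof.
move=> h; rewrite -(natcoefE _ h) /natcoef dirsum_mkE /= !natcoefE.
by rewrite /partialop /delta /=; case: (odd (m - q)).
Qed.

(** For [M] either [N] or [N pi], the cross terms vanish by
    [b (1 - tau) = (1 - tau) b'] and [b' M = M b], and only the product [E] of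
    [1 - tau] and [M] survives, two columns to the left. *)
Lemma natd_natd (M : forall q, {linear C q -> C q}) (E : forall q, C q -> C q) :
  (forall q (x : C q), M q x - pctau (M q x) = E q x) ->
  (forall q (x : C q), M q (x - pctau x) = E q x) ->
  (forall q (x : C q.+1), pcb' (M q.+1 x) = M q (pcb x)) ->
  forall m (y : natC C m.+2), natd M (natd M y) = natS (natmap E y).
Proof.
move=> M1 M2 M3 m y; apply: coefP => q h.
rewrite coef_natd // coef_natS // coef_natmap 1?leqW 1?leqW //.
rewrite (coef_natd _ _ (leqW h)) (coef_natd _ _ (h : (q < m.+1)%N)).
rewrite subSS subSn //=.
case: (odd (m - q)) => /=.
  by rewrite [M q _]linearD [pcb' (_ - _)]linearB /= pcb'_pcb' subr0 M3 addrK
    M2.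
rewrite [pctau (_ - _)]linearB /= [pcb (_ + _)]linearD /=.
rewrite pcb_pcb addr0 pcb_1Btau.
by rewrite -M1 opprB addrACA [X in _ + X]addrC !addrA subrK subrK.
Qed.

Section NatMap.
Variable f : forall q, {linear C q -> C q}.

Lemma natmap_is_linear m : linear (@natmap k C f m).
Proof.
move=> a x y; apply: coefP => q h.
by rewrite coef_is_linear !coef_natmap // coef_is_linear linearP.
Qed.

Lemma natmap_natS m (y : natC C m.+2) : natmap f (natS y) = natS (natmap f y).
Proof.
apply: coefP => q h.
by rewrite coef_natmap // !coef_natS // coef_natmap // !leqW.
Qed.

Lemma natmap_natd (M M' : forall q, C q -> C q) :
  (forall q (x : C q), f q (M q x) = M' q (f q x)) ->
  (forall q (x : C q), f q (pctau x) = pctau (f q x)) ->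
  (forall q (x : C q.+1), f q (pcb x) = pcb (f q.+1 x)) ->
  (forall q (x : C q.+1), f q (pcb' x) = pcb' (f q.+1 x)) ->
  forall m (y : natC C m.+1), natmap f (natd M y) = natd M' (natmap f y).
Proof.
move=> fM ft fb fb' m y; apply: coefP => q h.
rewrite coef_natmap // !coef_natd // !coef_natmap // 1?leqW //.
by case: ifP => _; rewrite !linearD linearN /= ?fM ?ft ?fb ?fb'.
Qed.

End NatMap.

Lemma natd_is_linear (M : forall q, {linear C q -> C q}) m :
  linear (@natd k C M m).
Proof.
move=> a x y; apply: coefP => q h.
rewrite coef_is_linear !coef_natd // !coef_is_linear.
case: ifP => _; rewrite !linearP /=.
  by rewrite scalerDr addrACA.
by rewrite [X in X + _ = _]addrACA [LHS]addrACA -!scalerDr.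
Qed.

Lemma natS_is_linear m : linear (@natS k C m).
Proof.
move=> a x y; apply: coefP => q h.
by rewrite coef_is_linear !coef_natS // coef_is_linear.
Qed.

Lemma natd_natS M m (y : natC C m.+3) : natd M (natS y) = natS (natd M y).
Proof.
apply: coefP => q h; have h1 := leqW h; have h2 := leqW h1.
by rewrite coef_natS // !coef_natd // !coef_natS // !subSn //= negbK.
Qed.

Lemma natmap_pcT_bij m : bijective (@natmap k C (@pcT k C) m).
Proof.
have inv q : {g : C q -> C q | cancel (@pcT k C q) g /\ cancel g (@pcT k C q)}.
  by apply: cid; case: (pcT_bij q) => g gK Kg; exists g.
exists (fun y => natmap (fun q => projT1 (inv q)) y) => y; apply: coefP => q h;
  rewrite !coef_natmap //; case: (inv q) => g [gK Kg] /=.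
  exact: gK.
exact: Kg.
Qed.

Lemma natnat_paraS : is_paraS (natnat C).
Proof.
split=> [|m x|].
- split=> m; [exact: natd_is_linear | exact: natS_is_linear
             | exact: natmap_is_linear | exact: natmap_pcT_bij].
- rewrite /= (natd_natd (M := fun q => @pcN k C q)
    (@pcN_sub_pctau) (@pcN_1Btau) (@pcb'_pcN)).
  congr natS; apply: coefP => q h.
  by rewrite coefB !coef_natmap.
- split=> m x /=; first exact: natd_natS.
    symmetry; apply: (natmap_natd (f := fun q => @pcT k C q)) => q y.
    + by rewrite /= pcN_pcT.
    + by rewrite /= pctau_pcT.
    + by rewrite /= pcb_pcT.
    + by rewrite /= pcb'_pcT.
  by rewrite (natmap_natS (fun q => @pcT k C q)).
Qed.

(** * The projection onto ker (1 - T) and the partial inverse of 1 - T *)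

Hypothesis hC : quasi_precyclic C.

Lemma ker1TP m (y : C m) : ker1T y <-> pcT y = y.
Proof.
rewrite /ker1T; split=> [/eqP|->]; last by rewrite subrr.
by rewrite subr_eq0 => /eqP.
Qed.

Lemma ker1T_lin m a (x y : C m) : ker1T x -> ker1T y -> ker1T (a *: x + y).
Proof. by rewrite !ker1TP linearP /= => -> ->. Qed.

Lemma ran1T_lin m a (x y : C m) : ran1T x -> ran1T y -> ran1T (a *: x + y).
Proof.
move=> [x' ->] [y' ->]; exists (a *: x' + y').
by rewrite linearP /= scalerBr opprD addrACA.
Qed.

(** [1 - T] is injective on its range since the range meets the kernel in 0. *)
Lemma ker_ran1T_eq m (x y : C m) : ran1T x -> ran1T y ->
  x - pcT x = y - pcT y -> x = y.
Proof.
move=> rx ry e; apply/eqP; rewrite -subr_eq0 addrC -scaleN1r; apply/eqP.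
apply: (proj2 (hC m)); last exact: ran1T_lin.
rewrite /ker1T linearP /= !scaleN1r opprD opprK addrACA.
by rewrite e addrACA addNr subrr addr0.
Qed.

Lemma piT_spec m (x : C m) : ker1T (piT x) /\ ran1T (x - piT x).
Proof.
rewrite /piT; apply: (@xgetPex _ _ (fun y : C m => ker1T y /\ ran1T (x - y))).
case: (proj1 (hC m) x) => y [z [ky rz ->]]; exists y.
by split=> //; rewrite addrC addKr.
Qed.

Lemma piT_unique m (x y : C m) : ker1T y -> ran1T (x - y) -> piT x = y.
Proof.
move=> ky rxy; have [kp rp] := piT_spec x.
suff: x - y = x - piT x by move/addrI/oppr_inj.
apply: ker_ran1T_eq => //.
rewrite !linearB /= (proj1 (ker1TP _) ky) (proj1 (ker1TP _) kp).
by rewrite addrACA subrr [RHS]addrACA subrr.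
Qed.

(** The operator [R]: the inverse of [1 - T] on [ran (1 - T)], extended by 0 on
    [ker (1 - T)]. *)
Definition inv1T m (x : C m) : C m :=
  xget 0 (fun y : C m => ran1T y /\ y - pcT y = x - piT x).

(** [1 - T] maps [ran (1 - T)] onto itself: in [(1 - T) z] only the component of
    [z] in the range matters. *)
Lemma inv1T_spec m (x : C m) :
  ran1T (inv1T x) /\ inv1T x - pcT (inv1T x) = x - piT x.
Proof.
rewrite /inv1T.
apply: (@xgetPex _ _ (fun y : C m => ran1T y /\ y - pcT y = x - piT x)).
have [_ [z ->]] := piT_spec x.
case: (proj1 (hC m) z) => y [w [ky rw ->]]; exists w; split=> //.
by rewrite linearD /= (proj1 (ker1TP _) ky) opprD addrACA subrr add0r.
Qed.

Lemma inv1T_unique m (x y : C m) :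
  ran1T y -> y - pcT y = x - piT x -> inv1T x = y.
Proof.
move=> ry ey; have [ri ei] := inv1T_spec x.
by apply: ker_ran1T_eq => //; rewrite ei ey.
Qed.

Fact piT_is_linear m : linear (@piT k C m).
Proof.
move=> a x y; have [kx rx] := piT_spec x; have [ky ry] := piT_spec y.
apply: piT_unique; first exact: ker1T_lin.
have := ran1T_lin a rx ry.
by rewrite scalerBr addrACA -opprD.
Qed.

HB.instance Definition _ m := GRing.isLinear.Build k (C m) (C m) *:%R
  (@piT k C m) (@piT_is_linear m).

Fact inv1T_is_linear m : linear (@inv1T m).
Proof.
move=> a x y; have [rx ex] := inv1T_spec x; have [ry ey] := inv1T_spec y.
apply: inv1T_unique; first exact: ran1T_lin.
by rewrite !linearP /= addrACA -scalerDr ex ey scalerDr addrACA.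
Qed.

HB.instance Definition _ m := GRing.isLinear.Build k (C m) (C m) *:%R
  (@inv1T m) (@inv1T_is_linear m).

(** A linear map commuting with [T] preserves both summands, and [pi] and [R]
    are characterized by them. *)
Section Commute.
Variables (m n : nat) (f : {linear C m -> C n}).
Hypothesis f_pcT : forall x, f (pcT x) = pcT (f x).

Lemma ran1T_map x : ran1T x -> ran1T (f x).
Proof. by move=> [y ->]; exists (f y); rewrite linearB f_pcT. Qed.

Lemma piT_map x : f (piT x) = piT (f x).
Proof.
have [kx rx] := piT_spec x; symmetry; apply: piT_unique.
  by apply/ker1TP; rewrite -f_pcT (proj1 (ker1TP _) kx).
by rewrite -linearB; apply: ran1T_map.
Qed.

Lemma inv1T_map x : f (inv1T x) = inv1T (f x).
Proof.
have [rx ex] := inv1T_spec x; symmetry; apply: inv1T_unique.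
  exact: ran1T_map.
by rewrite -f_pcT -linearB ex linearB piT_map.
Qed.

End Commute.

Lemma pcT_piT m (x : C m) : pcT (piT x) = piT x.
Proof. exact/ker1TP/(proj1 (piT_spec x)). Qed.

Lemma piT_pcT m (x : C m) : piT (pcT x) = piT x.
Proof. by rewrite -(piT_map (f := @pcT k C m)) //= pcT_piT. Qed.

Lemma piT_piT m (x : C m) : piT (piT x) = piT x.
Proof.
apply: piT_unique; first exact: (proj1 (piT_spec x)).
by exists 0; rewrite subrr linear0 subr0.
Qed.

(** This and [pctau_pcN_inv1T] are the two horizontal identities behind the
    homotopy, on the odd and on the even columns. *)
Lemma pcN_inv1T m (x : C m) : pcN (inv1T (x - pctau x)) = x - piT x.
Proof.
have [_ <-] := inv1T_spec x.
have -> : pcN (inv1T (x - pctau x)) = inv1T (pcN (x - pctau x)).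
  exact: (inv1T_map (@pcN_pcT m)).
rewrite pcN_1Btau linearB /=.
by rewrite [inv1T (pcT x)](esym (inv1T_map (f := @pcT k C m) _ _)).
Qed.

Lemma pctau_pcN_inv1T m (x : C m) :
  pcN (inv1T x) - pctau (pcN (inv1T x)) = x - piT x.
Proof. by rewrite pcN_sub_pctau (proj2 (inv1T_spec x)). Qed.

Lemma piT_sub_id m (x : C m) :
  piT x - x = - pcN (inv1T x) - pctau (- pcN (inv1T x)).
Proof. by rewrite [pctau (- _)]linearN -opprD pctau_pcN_inv1T opprB. Qed.

Lemma piT_pctau m (x : C m) : piT (pctau x) = pctau (piT x).
Proof. by symmetry; apply: (piT_map (@pctau_pcT m)). Qed.

Lemma piT_pcN m (x : C m) : piT (pcN x) = pcN (piT x).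
Proof. by symmetry; apply: (piT_map (@pcN_pcT m)). Qed.

Lemma piT_pcb m (x : C m.+1) : piT (pcb x) = pcb (piT x).
Proof. by symmetry; apply: (piT_map (@pcb_pcT m)). Qed.

Lemma piT_pcb' m (x : C m.+1) : piT (pcb' x) = pcb' (piT x).
Proof. by symmetry; apply: (piT_map (@pcb'_pcT m)). Qed.

Lemma pcb'_pcN_inv1T m (x : C m.+1) :
  pcb' (pcN (inv1T x)) = pcN (inv1T (pcb x)).
Proof. by rewrite pcb'_pcN (inv1T_map (@pcb_pcT m)). Qed.

Fact pcNtilde_is_linear m : linear (@pcNtilde k C m).
Proof. by move=> a x y; rewrite /pcNtilde !linearP. Qed.

HB.instance Definition _ m := GRing.isLinear.Build k (C m) (C m) *:%R
  (@pcNtilde k C m) (@pcNtilde_is_linear m).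

Lemma pcb'_pcNtilde m (x : C m.+1) : pcb' (pcNtilde x) = pcNtilde (pcb x).
Proof. by rewrite /pcNtilde pcb'_pcN piT_pcb. Qed.

Lemma pcNtilde_sub_pctau m (x : C m) : pcNtilde x - pctau (pcNtilde x) = 0.
Proof. by rewrite pcN_sub_pctau pcT_piT subrr. Qed.

Lemma pcNtilde_1Btau m (x : C m) : pcNtilde (x - pctau x) = 0.
Proof.
have -> : pcNtilde (x - pctau x) = pcN (piT x - pctau (piT x)).
  by rewrite -piT_pctau -linearB.
by rewrite pcN_1Btau pcT_piT subrr.
Qed.

(** * The bicomplex and the S-module *)

Lemma CCtilde_bicomplex :
  is_chain_bicomplex (B := CC C) (partialop (@pcNtilde k C)) (@deltahat k C).
Proof.
split=> [|p q x|p q x|p q x]; rewrite /partialop /deltahat /=.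
- split=> p q a x y; case: (odd p); rewrite /= ?linearP //=.
  by rewrite addrACA -scalerDr.
- by case: (odd p) => /=; rewrite ?pcNtilde_1Btau ?pcNtilde_sub_pctau.
- by case: (odd p); rewrite ?pcb_pcb ?pcb'_pcb'.
- by case: (odd p); rewrite /= ?pcb'_pcNtilde ?pcb_1Btau.
Qed.

Lemma natnat_tilde_S_module : is_S_module (natnat_tilde C).
Proof.
split=> //; split=> [|m x|].
- split=> m; [exact: natd_is_linear | exact: natS_is_linear
             | by move=> a x y | by exists id].
- by rewrite /= subrr (natd_natd (M := fun q => @pcNtilde k C q)
    (@pcNtilde_sub_pctau) (@pcNtilde_1Btau) (@pcb'_pcNtilde)).
- by split=> m x //=; exact: natd_natS.
Qed.

(** * The homotopy equivalence *)

Lemma natpi_natd (M M' : forall q, C q -> C q) :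
  (forall q (x : C q), piT (M q x) = M' q (piT x)) ->
  forall m (y : natC C m.+1), natpi (natd M y) = natd M' (natpi y).
Proof.
move=> piM; apply: (natmap_natd (f := fun q => @piT k C q)) => // q y.
- exact: piT_pctau.
- exact: piT_pcb.
- exact: piT_pcb'.
Qed.

Lemma natpi_S_map_to_tilde :
  @is_S_map k (natnat C) (natnat_tilde C) (@natpi k C).
Proof.
split=> [m|m x|m x|m x] /=.
- exact: (natmap_is_linear (fun q => @piT k C q)).
- by apply: natpi_natd => q y; rewrite /pcNtilde piT_pcN piT_piT.
- exact: (natmap_natS (fun q => @piT k C q)).
- by apply: coefP => q h; rewrite !coef_natmap // piT_pcT.
Qed.

Lemma natpi_S_map_from_tilde :
  @is_S_map k (natnat_tilde C) (natnat C) (@natpi k C).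
Proof.
split=> [m|m x|m x|m x] /=.
- exact: (natmap_is_linear (fun q => @piT k C q)).
- by apply: natpi_natd => q y; rewrite /pcNtilde piT_pcN piT_piT.
- exact: (natmap_natS (fun q => @piT k C q)).
- by apply: coefP => q h; rewrite !coef_natmap // pcT_piT.
Qed.

(** The homotopy [x u^(2p) |-> - N R x u^(2p+1)], zero on odd powers of [u].
    The coefficient in [C_(m+1)] of the image is 0 as well, since
    [coef y m.+1] is. *)
Definition natphi m (y : natC C m) : natC C m.+1 :=
  dirsum_mk (fun q : 'I_m.+2 =>
    if odd (m - q) then 0 : CC C (m.+1 - q) q else - pcN (inv1T (coef y q))).

Lemma coef_natphi m (y : natC C m) q : (q <= m.+1)%N ->
  coef (natphi y) q = if odd (m - q) then 0 else - pcN (inv1T (coef y q)).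
Proof.
exact: (@coef_mk m.+1
  (fun q => if odd (m - q) then 0 else - pcN (inv1T (coef y q)))).
Qed.

Lemma natphi_is_linear m : linear (@natphi m).
Proof.
move=> a x y; apply: coefP => q h.
rewrite coef_is_linear !coef_natphi // coef_is_linear.
by case: ifP => _; rewrite ?scaler0 ?addr0 // !linearP.
Qed.

(** Only the coefficient in [C_(m+1)] needs an argument: on the left it comes
    from the odd power [u^1] and hence is 0, as it is on the right. *)
Lemma natphi_natS m (y : natC C m.+2) : natS (natphi y) = natphi (natS y).
Proof.
apply: coefP => q h; rewrite coef_natS // !coef_natphi // 1?leqW 1?leqW //.
case: (ltngtP q m.+1) h => // [lt_qm|->] _.
  by rewrite coef_natS // !subSn ?leqW //= negbK.
by rewrite subSnn [coef (natS y) _]coef_gt // !linear0; case: ifP.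
Qed.

Lemma natphi_natmap m (y : natC C m) :
  natmap (@pcT k C) (natphi y) = natphi (natmap (@pcT k C) y).
Proof.
apply: coefP => q h; rewrite coef_natmap // !coef_natphi //.
case: ifP => odd_mq; first by rewrite linear0.
rewrite linearN /= -pcN_pcT; congr (- pcN _).
have -> : coef (natmap (@pcT k C) y) q = pcT (coef y q).
  case: (leqP q m) => lt_mq; first by rewrite coef_natmap.
  by rewrite !coef_gt // linear0.
exact: (inv1T_map (f := @pcT k C q)).
Qed.

(** In the odd columns the vertical terms cancel by [b' N R = N R b] and the
    identity is [pcN_inv1T]; in the even ones it is [pctau_pcN_inv1T].  The
    column [u^0], where [q = m + 1], is an even one. *)
Lemma natpi_homotopy (M : forall q, {linear C q -> C q}) m (y : natC C m.+1) :
  natmap (@piT k C) y - y = natd M (natphi y) + natphi (natd M y).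
Proof.
apply: coefP => q h; rewrite coefB coefD coef_natmap //.
have h1 := leqW h; rewrite coef_natd // !coef_natphi // subSS.
case: (ltngtP q m.+1) h => // [lt_qm|->] _.
  rewrite coef_natd // subSn //=; case: (odd (m - q)) => /=.
    by rewrite linear0 !addr0 piT_sub_id.
  rewrite linear0 add0r linearN /= opprK pcb'_pcN_inv1T.
  rewrite [inv1T (_ + pcb _)]linearD [pcN (_ + inv1T (pcb _))]linearD /=.
  by rewrite opprD addrCA subrr addr0 pcN_inv1T opprB.
rewrite subnn (eqP (leqnSn m)) /= [coef (natd _ _) _]coef_gt //.
by rewrite [coef y m.+2]coef_gt // !linear0 !addr0 piT_sub_id.
Qed.

(** Degree 0 consists of the single column [u^0], where only [d phi] occurs. *)
Lemma natpi_homotopy0 (M : forall q, {linear C q -> C q}) (y : natC C 0) :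
  natmap (@piT k C) y - y = natd M (natphi y).
Proof.
apply: coefP => q; rewrite leqn0 => /eqP->; rewrite coefB coef_natmap //.
rewrite coef_natd // !coef_natphi //= [coef y 1]coef_gt // !linear0 addr0.
exact: piT_sub_id.
Qed.

Lemma natpi_natpi m (y : natC C m) : natpi (natpi y) = natpi y.
Proof. by apply: coefP => q h; rewrite !coef_natmap // piT_piT. Qed.

Lemma natS_natphi1 (y : natC C 1) : natS (natphi y) = 0.
Proof.
apply: coefP => q; rewrite leqn0 => /eqP->.
rewrite coef_natS // coef_natphi //=.
by rewrite -[0 in RHS]subr0 coefB subrr.
Qed.

Lemma natpi_equivalence : S_homotopy_equivalence
  (X := natnat C) (Y := natnat_tilde C) (@natpi k C) (@natpi k C).
Proof.
split.
- by split; [exact: natnat_paraS | exact: (proj1 natnat_tilde_S_module)].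
- exact: natpi_S_map_to_tilde.
- exact: natpi_S_map_from_tilde.
- exists natphi; split.
  + exact: natphi_is_linear.
  + by split=> [m x|x]; [exact: natphi_natS | exact: natS_natphi1].
  + exact: natphi_natmap.
  + by split=> [x|m x]; rewrite natpi_natpi;
      [exact: (natpi_homotopy0 (fun q => @pcN k C q))
      | exact: (natpi_homotopy (fun q => @pcN k C q))].
- exists natphi; split.
  + exact: natphi_is_linear.
  + by split=> [m x|x]; [exact: natphi_natS | exact: natS_natphi1].
  + by [].
  + by split=> [x|m x]; rewrite natpi_natpi;
      [exact: (natpi_homotopy0 (fun q => @pcNtilde k C q))
      | exact: (natpi_homotopy (fun q => @pcNtilde k C q))].
Qed.

End QuasiPrecyclic.

Theorem proposition6p9 (k : pzRingType) (C : paraPrecyclic k)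
    (hC : quasi_precyclic C) :
  (is_chain_bicomplex (B := CC C) (partialop (@pcNtilde k C)) (@deltahat k C) /\
   is_S_module (natnat_tilde C)) /\
  S_homotopy_equivalence (X := natnat C) (Y := natnat_tilde C)
    (@natpi k C) (@natpi k C).
Proof.
split; last exact: natpi_equivalence.
by split; [exact: CCtilde_bicomplex | exact: natnat_tilde_S_module].
Qed.
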